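(* Let $S,A$ be finite nonempty sets, let $Q_\theta:S\times A\to\mathbb{R}$ be a function approximator differentiable in its parameter $\theta\in\mathbb{R}^d$, and let $\Phi_\theta\in\mathbb{R}^{d\times|S||A|}$ be the matrix whose columns are the gradients $\nabla_\theta Q_\theta(s,a)$, $(s,a)\in S\times A$. Then $$(\Phi_\theta\Phi_\theta^T)^\dagger\,\Phi_\theta=\Phi_\theta\,(\Phi_\theta^T\Phi_\theta)^\dagger .$$
   Context: $M^\dagger$ denotes the Moore–Penrose pseudoinverse of a real matrix $M$. No rank assumption is made on $\Phi_\theta$. *)

(* Defs.v *)
From HB Require Import structures.
From mathcomp Require Import all_boot all_order all_algebra.
From mathcomp Require Import all_classical all_reals all_analysis.

Set Implicit Arguments.
Unset Strict Implicit.
Unset Printing Implicit Defensive.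

Import Order.TTheory GRing.Theory Num.Theory.
Import numFieldNormedType.Exports.

Local Open Scope classical_set_scope.
Local Open Scope ring_scope.

Definition penrose (R : realFieldType) (m n : nat)
    (M : 'M[R]_(m, n)) (X : 'M[R]_(n, m)) : Prop :=
  [/\ M *m X *m M = M,
      X *m M *m X = X,
      (M *m X)^T = M *m X &
      (X *m M)^T = X *m M].

(* The default 0 is never used: a solution of the Penrose equations always     *)
(* exists and is unique (mppinvP and penrose_uniq below).                      *)
(* Not to be confused with pinvmx, which is only some generalized inverse.     *)
Definition mppinv (R : realFieldType) (m n : nat) (M : 'M[R]_(m, n)) :
    'M[R]_(n, m) :=
  xget 0 [set X | penrose M X].

Definition gradient (R : realType) (d : nat) (f : 'cV[R]_d -> R)
    (theta : 'cV[R]_d) : 'cV[R]_d :=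
  \col_i 'D_(delta_mx i 0) f theta.

(* The columns are indexed by S * A, listed in the order of its canonical      *)
(* enumeration; #|{: S * A}| = (#|S| * #|A|)%N by card_prod.                   *)
Definition feature_mx (R : realType) (d : nat) (S A : finType)
    (Q : 'cV[R]_d -> S * A -> R) (theta : 'cV[R]_d) :
    'M[R]_(d, #|{: S * A}|) :=
  \matrix_(i, j) gradient (fun t => Q t (enum_val j)) theta i 0.

Lemma penrose_uniq (R : realFieldType) (m n : nat) (M : 'M[R]_(m, n))
    (X Y : 'M[R]_(n, m)) : penrose M X -> penrose M Y -> X = Y.
Proof.
case=> X1 X2 X3 X4 [Y1 Y2 Y3 Y4].
have MXY : M *m X = M *m Y.
  rewrite -X3 -{1}Y1 -(mulmxA _ M X) trmx_mul X3 Y3.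
  by rewrite mulmxA X1.
have XMY : X *m M = Y *m M.
  rewrite -X4 -{1}Y1 2!mulmxA -(mulmxA (X *m M)) trmx_mul X4 Y4.
  by rewrite -!mulmxA (mulmxA M X) X1.
by rewrite -X2 XMY -mulmxA MXY mulmxA Y2.
Qed.

Lemma gram_unitmx (R : realFieldType) (r n : nat) (B : 'M[R]_(r, n)) :
  row_free B -> B *m B^T \in unitmx.
Proof.
move=> Bfree; rewrite -row_free_unit -kermx_eq0.
apply/eqP/row_matrixP => i; rewrite row0.
have : row i (kermx (B *m B^T)) *m (B *m B^T) = 0.
  by rewrite -row_mul mulmx_ker row0.
set v := row i _ => vBB.
have vB0 : v *m B = 0.
  have: (v *m B) *m (v *m B)^T = 0.
    by rewrite trmx_mul mulmxA -(mulmxA v) vBB mul0mx.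
  move=> /matrixP /(_ 0 0); rewrite !mxE => vB.
  apply/rowP => j; rewrite [RHS]mxE; apply/eqP.
  have /psumr_eq0P := vB.
  have ge0 (k : 'I_n) : true -> 0 <= (v *m B) 0 k * (v *m B)^T k 0.
    by rewrite [_^T _ _]mxE -expr2 sqr_ge0.
  by move=> /(_ ge0 j isT) /eqP; rewrite [_^T _ _]mxE mulf_eq0 orbb.
by apply: (row_free_inj Bfree); rewrite vB0 mul0mx.
Qed.

Lemma penrose_ex (R : realFieldType) (m n : nat) (M : 'M[R]_(m, n)) :
  exists X, penrose M X.
Proof.
have [r [C [B [MCB uC uB]]]] : exists r (C : 'M[R]_(m, r)) (B : 'M[R]_(r, n)),
    [/\ M = C *m B, C^T *m C \in unitmx & B *m B^T \in unitmx].
  exists (\rank M), (col_base M), (row_base M); split; first by rewrite mulmx_base.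
    rewrite -{2}[col_base M]trmxK; apply: gram_unitmx.
    by rewrite /row_free mxrank_tr; have := col_base_full M.
  exact/gram_unitmx/row_base_free.
pose G := invmx (B *m B^T); pose H := invmx (C^T *m C).
have GT : G^T = G by rewrite /G trmx_inv trmx_mul trmxK.
have HT : H^T = H by rewrite /H trmx_inv trmx_mul trmxK.
pose X := B^T *m G *m H *m C^T.
have MX : M *m X = C *m H *m C^T.
  by rewrite MCB /X !mulmxA -(mulmxA C B) -(mulmxA C _ G) mulmxV // mulmx1.
have XM : X *m M = B^T *m G *m B.
  by rewrite MCB /X !mulmxA -(mulmxA _ C^T C) -(mulmxA _ H) mulVmx // mulmx1.
exists X; split.
- by rewrite MX MCB !mulmxA -(mulmxA _ C^T C) -(mulmxA C H) mulVmx // mulmx1.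
- by rewrite XM /X !mulmxA -(mulmxA _ B B^T) -(mulmxA _ _ G) mulmxV // mulmx1.
- by rewrite MX !trmx_mul trmxK HT mulmxA.
- by rewrite XM !trmx_mul trmxK GT mulmxA.
Qed.

Lemma mppinvP (R : realFieldType) (m n : nat) (M : 'M[R]_(m, n)) :
  penrose M (mppinv M).
Proof. by have [X MX] := penrose_ex M; apply: (@xgetI _ _ _ X MX). Qed.

(* Main.v *)
(* Writing P for the pseudoinverse of M, one has (M M^T)^+ = P^T P and
   (M^T M)^+ = P P^T, and both sides of the identity reduce to
   P^T = (M^T)^+. *)

Require Import Defs.
From mathcomp Require Import all_boot all_order all_algebra.
From mathcomp Require Import all_classical all_reals all_analysis.
Set Implicit Arguments.
Unset Strict Implicit.
Unset Printing Implicit Defensive.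
Import Order.TTheory GRing.Theory Num.Theory.
Import numFieldNormedType.Exports.
Local Open Scope classical_set_scope.
Local Open Scope ring_scope.

(** Uniqueness in the Penrose equations lets a pseudoinverse be identified by verifying a candidate.
    [penrose_mulmx_tr] does so for [M *m M^T]; [penrose_tr] carries the result to [M^T *m M], for a
    matrix [M] of any rank. *)

Lemma mppinv_penrose (R : realFieldType) (m n : nat) (M : 'M[R]_(m, n))
    (X : 'M[R]_(n, m)) : penrose M X -> mppinv M = X.
Proof. exact/penrose_uniq/mppinvP. Qed.

Lemma penrose_tr (R : realFieldType) (m n : nat) (M : 'M[R]_(m, n))
    (X : 'M[R]_(n, m)) : penrose M X -> penrose M^T X^T.
Proof.
case=> MXM XMX MXs XMs.
by split; rewrite -!trmx_mul ?mulmxA ?MXM ?XMX ?XMs ?MXs.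
Qed.

(** In either order, the product of [M *m M^T] and [X^T *m X] collapses to [M *m X], the orthogonal
    projector onto the column space of [M]. *)
Lemma penrose_mulmx_tr (R : realFieldType) (m n : nat) (M : 'M[R]_(m, n))
    (X : 'M[R]_(n, m)) : penrose M X -> penrose (M *m M^T) (X^T *m X).
Proof.
case=> MXM XMX MXs XMs.
have GX : M *m M^T *m (X^T *m X) = M *m X.
  by rewrite mulmxA -(mulmxA M) -trmx_mul XMs !mulmxA MXM.
have XG : X^T *m X *m (M *m M^T) = M *m X.
  by rewrite mulmxA -(mulmxA X^T) -XMs -!trmx_mul XMX.
split; rewrite ?GX ?XG //; first by rewrite mulmxA MXM.
by rewrite -{1}MXs mulmxA -trmx_mul mulmxA XMX.
Qed.

Lemma mppinv_gram_mulmx (R : realFieldType) (m n : nat) (M : 'M[R]_(m, n)) :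
  mppinv (M *m M^T) *m M = M *m mppinv (M^T *m M).
Proof.
have MP := mppinvP M; have [_ XMX MXs XMs] := MP.
have /mppinv_penrose -> := penrose_mulmx_tr MP.
have := penrose_mulmx_tr (penrose_tr MP).
rewrite !trmxK => /mppinv_penrose ->.
(* By symmetry of the projectors [X *m M] and [M *m X], with [X := mppinv M], each side is the
   transpose of [X *m M *m X], that is [X^T]. *)
by rewrite -mulmxA -XMs mulmxA -MXs -!trmx_mul XMX mulmxA XMX.
Qed.

Theorem lemma4 (R : realType) (d : nat) (S A : finType)
    (hS : (0 < #|S|)%N) (hA : (0 < #|A|)%N)
    (Q : 'cV[R]_d -> S * A -> R)
    (hQ : forall (sa : S * A) (theta : 'cV[R]_d),
      differentiable (fun t : 'cV[R]_d => Q t sa) theta)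
    (theta : 'cV[R]_d) :
  let Phi := feature_mx Q theta in
  mppinv (Phi *m Phi^T) *m Phi = Phi *m mppinv (Phi^T *m Phi).
Proof.
exact: mppinv_gram_mulmx.
Qed.
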